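(* Let $R$ be a Rickart *-ring with proper involution. For all $a,b\in R$ the following assertions are equivalent: (a) $a\preceq b$; (b) $b=a+c$ for some $c\in R$ with $c\perp a$; (c) $ba''=a=(a^* )''b$; (d) $fb=a=be$ for some $e,f\in P$; (e) $a=ba''$ and $a''$ commutes with $b^*b$; (f) $a=ba''$ and $a^*b\in S$.
   Context: A *-ring is an associative ring $R$ with an involution $x\mapsto x^*$ (additive, $(xy)^*=y^*x^*$, $x^{**}=x$). A projection is an element $e$ with $e^2=e=e^*$; $P$ denotes the set of projections of $R$. $R$ is a Rickart *-ring if the right annihilator of every element is generated by a projection, i.e. to each $x\in R$ there is a (necessarily unique) projection $x'$ such that for all $y\in R$: $xy=0$ iff $y=x'y$. Then $R$ has the unit $1:=0'$, and $e'=1-e$ for $e\in P$. Write $x'':=(x')'$. $S:=\{x\in R: x^*=x\}$ is the set of self-adjoint elements. Elements $x,y$ are *-orthogonal, $x\perp y$, if $xy^*=0=x^*y$. The involution is proper if $x^*x=0$ implies $x=0$. The star order on $R$ is the partial order defined by: $x\preceq y$ iff $x\perp y-x$; equivalently, $x^*x=x^*y$ and $xx^*=yx^*$. *)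

(* Defs.v *)
From HB Require Import structures.
From mathcomp Require Import all_boot ssralg.

Set Implicit Arguments.
Unset Strict Implicit.
Unset Printing Implicit Defensive.

Import GRing.Theory.
Local Open Scope ring_scope.

Declare Scope star_scope.
Delimit Scope star_scope with star.

HB.mixin Record isStarRing R of GRing.PzRing R := {
  star : R -> R;
  starD : {morph star : x y / x + y};
  starM : forall x y, star (x * y) = star y * star x;
  starK : involutive star
}.

#[short(type="starRingType")]
HB.structure Definition StarRing := {R of isStarRing R & GRing.PzRing R}.

Notation "x ^*" := (star x) : star_scope.
Local Open Scope star_scope.

Definition projection {R : starRingType} : {pred R} :=
  [pred e | (e * e == e) && (e^* == e)].

Definition selfadjoint {R : starRingType} : {pred R} := [pred x | x^* == x].

Definition star_orth {R : starRingType} (x y : R) : Prop :=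
  x * y^* = 0 /\ x^* * y = 0.

Definition star_le {R : starRingType} (x y : R) : Prop := star_orth x (y - x).

Definition proper_star (R : starRingType) : Prop :=
  forall x : R, x^* * x = 0 -> x = 0.

Notation "x _|_ y" := (star_orth x y) (at level 70, no associativity) : star_scope.
Notation "x <=* y" := (star_le x y) (at level 70, no associativity) : star_scope.

(* [rann x] is the projection x' generating the right annihilator of x. It is
   uniquely determined by [rann_proj] and [rannP] (see [rann_uniq]), so that
   carrying it as data does not restrict the class of rings. *)
HB.mixin Record StarRing_isRickart R of StarRing R := {
  rann : R -> R;
  rann_proj : forall x, rann x \in projection;
  rannP : forall x y, x * y = 0 <-> y = rann x * y
}.

#[short(type="rickartStarRingType")]
HB.structure Definition RickartStarRing :=
  {R of StarRing_isRickart R & StarRing R}.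

Notation "x ^'" := (rann x) (at level 1, format "x ^'") : star_scope.
Notation "x ^''" := (rann (rann x)) (at level 1, format "x ^''") : star_scope.

(* The unit of a Rickart *-ring need not be assumed: an associative ring,
   possibly without unit, that has an involution and right annihilators
   generated by projections is a unital ring with unit 0'. Through this factory
   every such ring is a [rickartStarRingType]. *)
HB.factory Record Zmodule_isRickartStarRing R of GRing.Zmodule R := {
  mul : R -> R -> R;
  mulA : associative mul;
  mulDl : left_distributive mul +%R;
  mulDr : right_distributive mul +%R;
  inv : R -> R;
  invD : {morph inv : x y / x + y};
  invM : forall x y, inv (mul x y) = mul (inv y) (inv x);
  invK : involutive inv;
  ann : R -> R;
  ann_idem : forall x, mul (ann x) (ann x) = ann x;
  ann_sa : forall x, inv (ann x) = ann x;
  annP : forall x y, mul x y = 0 <-> y = mul (ann x) y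
}.

HB.builders Context R of Zmodule_isRickartStarRing R.

Fact mul_ann0 : left_id (ann 0) mul.
Proof.
move=> y; apply/esym/annP.
by apply: (addrI (mul 0 y)); rewrite -mulDl !addr0.
Qed.

Fact mul0_ann : right_id (ann 0) mul.
Proof. by move=> y; rewrite -[LHS]invK invM ann_sa mul_ann0 invK. Qed.

HB.instance Definition _ :=
  GRing.Zmodule_isPzRing.Build R mulA mul_ann0 mul0_ann mulDl mulDr.

HB.instance Definition _ := isStarRing.Build R invD invM invK.

Fact ann_proj (x : R) : ann x \in projection.
Proof. by rewrite inE; apply/andP; split; apply/eqP; [exact: ann_idem|exact: ann_sa]. Qed.

HB.instance Definition _ := StarRing_isRickart.Build R ann_proj annP.

HB.end.

Lemma star_leP (R : starRingType) (x y : R) :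
  x <=* y <-> x^* * x = x^* * y /\ x * x^* = y * x^*.
Proof.
have starB (u v : R) : (u - v)^* = u^* - v^*.
  by apply: (addIr v^*); rewrite -starD !subrK.
rewrite /star_le /star_orth starB !mulrBr; split=> [[h1 h2]|[h1 h2]].
  split; first by apply/esym/eqP; rewrite -subr_eq0 h2.
  by rewrite -[y * x^*]starK [(y * _)^*]starM starK (subr0_eq h1) starM starK.
split; last by rewrite h1 subrr.
by rewrite -[x * y^*]starK starM starK -h2 starM starK subrr.
Qed.

Lemma rann_uniq (R : rickartStarRingType) (x e : R) :
  e \in projection -> (forall y, x * y = 0 <-> y = e * y) -> e = x^'.
Proof.
rewrite inE => /andP[/eqP ee /eqP se] eP.
have /[!inE]/andP[/eqP pp /eqP sp] := rann_proj x.
have h1 : e = x^' * e by apply/rannP/eP; rewrite ee.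
have h2 : x^' = e * x^' by apply/eP/rannP; rewrite pp.
by rewrite -se h1 starM se sp -h2.
Qed.

Lemma rann0 (R : rickartStarRingType) : (0 : R)^' = 1.
Proof. by have /rannP := mul0r (1 : R); rewrite mulr1. Qed.

Lemma rann_projE (R : rickartStarRingType) (e : R) :
  e \in projection -> e^' = 1 - e.
Proof.
have star1 : (1 : R)^* = 1 by rewrite -[LHS]mulr1 -[X in _ * X]starK -starM mulr1 starK.
have starB (u v : R) : (u - v)^* = u^* - v^*.
  by apply: (addIr v^*); rewrite -starD !subrK.
rewrite inE => /andP[/eqP ee /eqP se]; apply/esym/rann_uniq => [|y].
  by rewrite inE starB star1 se mulrBr mulr1 mulrBl mul1r ee subrr subr0 !eqxx.
rewrite mulrBl mul1r; split=> [->|h]; first by rewrite subr0.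
by apply: oppr_inj; apply: (addrI y); rewrite -h oppr0 addr0.
Qed.

(* Main.v *)
(* Everything rests on x x'' = x and on x'' having the same right annihilator
   as x.  For (d) => (e), a = a e gives a'' = e a'', hence b a'' = a, and
   b^* b a'' = b^* a = b^* f b is self-adjoint, so that a'' and b^* b commute.
   For (f) => (a), a^* a = a^* b a'' = b^* a a'' = b^* a = a^* b. *)
Require Import Defs.
From mathcomp Require Import all_boot ssralg.

Import GRing.Theory.
Local Open Scope ring_scope.
Local Open Scope star_scope.

Lemma star0 (R : starRingType) : (0 : R)^* = 0.
Proof. by apply: (addIr (0 : R)^*); rewrite -starD !add0r. Qed.

Lemma star_orthC (R : starRingType) (x y : R) : x _|_ y -> y _|_ x.
Proof.
case=> h1 h2; split.
  by rewrite -[LHS]starK starM starK h1 star0.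
by rewrite -[LHS]starK starM starK h2 star0.
Qed.

Lemma projectionP (R : starRingType) (e : R) :
  reflect (e * e = e /\ e^* = e) (e \in projection).
Proof. by rewrite inE; apply: (iffP andP) => -[/eqP ? /eqP ?]. Qed.

Section Rickart.
Variable R : rickartStarRingType.
Implicit Types x y e : R.

Lemma rann2E x : x^'' = 1 - x^'.
Proof. exact/rann_projE/rann_proj. Qed.

Lemma star_rann x : (x^')^* = x^'.
Proof. by case/projectionP: (rann_proj x). Qed.

Lemma mulr_rann2 x : x * x^'' = x.
Proof.
have -> : x * x^'' = x - x * x^' by rewrite rann2E mulrBr mulr1.
suff -> : x * x^' = 0 by rewrite subr0.
by apply/rannP; case/projectionP: (rann_proj x).
Qed.

Lemma mul_rann2_star x : x^'' * x^* = x^*.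
Proof. by rewrite -{1}(star_rann x^') -starM mulr_rann2. Qed.

(** Here [y = x' y], and [x'' = 1 - x'] kills it. *)
Lemma rann2_mul_eq0 x y : x * y = 0 -> x^'' * y = 0.
Proof. by move/rannP => h; rewrite rann2E mulrBl mul1r -h subrr. Qed.

(** As [x] kills [1 - e], so does [x''], whence [x'' = x'' e]; taking adjoints puts [e] on the left.
    Thus [x''] is the least projection fixing [x] from the right. *)
Lemma mul_rann2_proj x e : e \in projection -> x * e = x -> e * x^'' = x^''.
Proof.
case/projectionP=> _ se xe.
have : x^'' * (1 - e) = 0 by apply: rann2_mul_eq0; rewrite mulrBr mulr1 xe subrr.
rewrite mulrBr mulr1 => /subr0_eq h.
by rewrite -{1}se -(star_rann x^') -starM -h.
Qed.

End Rickart.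

Theorem theorem3p3 (R : rickartStarRingType) (Rproper : proper_star R)
    (a b : R) :
  [<-> a <=* b;
       exists c : R, b = a + c /\ c _|_ a;
       b * a^'' = a /\ a = (a^*)^'' * b;
       exists e f : R, [/\ e \in projection, f \in projection,
                          f * b = a & a = b * e];
       a = b * a^'' /\ GRing.comm a^'' (b^* * b);
       a = b * a^'' /\ a^* * b \in selfadjoint].
Proof.
tfae.
- by move=> h; exists (b - a); split; [rewrite addrC subrK | exact: star_orthC].
- case=> c [-> /star_orthC[ac aSc]]; split.
    (* From [a c^* = 0] comes [a'' c^* = 0], whose adjoint is [c a'' = 0]. *)
    rewrite mulrDl mulr_rann2 -[c * _]starK starM star_rann.
    by rewrite (rann2_mul_eq0 _ _ _ ac) star0 addr0.
  (* Dually, [a^* c = 0] makes [(a^* )''] kill [c], while it fixes [a] from the left. *)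
  by rewrite mulrDr (rann2_mul_eq0 _ _ _ aSc) addr0 -{3}[a]starK mul_rann2_star starK.
- case=> ba ab; exists a^'', (a^*)^''.
  by split; [exact: rann_proj | exact: rann_proj | |].
- case=> e [f [pe pf fb be]].
  have [[ee _] [_ sf]] := (projectionP _ _ pe, projectionP _ _ pf).
  have ba : b * a^'' = a.
    (* [a e = b e e = a] gives [e a'' = a''], so [b a'' = b e a'' = a a'']. *)
    rewrite -(mul_rann2_proj _ _ _ pe); last by rewrite be -mulrA ee.
    by rewrite mulrA -be mulr_rann2.
  split=> //; rewrite /GRing.comm -mulrA ba.
  rewrite -{1}(star_rann _ a^') mulrA -starM ba.
  by rewrite -fb starM sf mulrA.
- case=> ab comm_ab; split=> //.
  have ab_ba : a^* * b = b^* * a.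
    (* [a^* b = a'' b^* b = b^* b a'' = b^* a]. *)
    by rewrite {1}ab starM star_rann -mulrA comm_ab -mulrA -ab.
  by rewrite inE starM starK ab_ba.
- case=> ab; rewrite inE starM starK => /eqP sa.
  (* The second equation is [a a^* = b a'' a^* = b a^*]. *)
  apply/star_leP; split; last by rewrite {1}ab -mulrA mul_rann2_star.
  by rewrite {2}ab mulrA -sa -mulrA mulr_rann2.
Qed.
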